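(* Let $n\ge 1$ and $0\le m\le \binom{n}{2}$. For finite collections (multisets) $P$ and $Q$ of graphs with $n$ vertices and $m$ edges, if $\Delta_1X_P=\Delta_1X_Q$ then $d_1X_P=d_1X_Q$.
   Context: All graphs are simple. For a graph $G$ with $n$ vertices and $m$ edges, the $1$-edge deck $ED_1(G)$ is the multiset of the graphs $G-e$, $e\in E(G)$; the modified $1$-deck $MD_1(G)$ is the multiset of graphs $G-e+f$ where $e\in E(G)$ and $f$ ranges over all non-edges of $G-e$ (including $f=e$). For a finite multiset $S$ of graphs, its characteristic vector $X_S$ is indexed by isomorphism classes of $n$-vertex graphs with the relevant number of edges, the entry at a class being the number of members of $S$ in that class. $d_1$ is the matrix with rows indexed by isomorphism classes of $n$-vertex $(m-1)$-edge graphs and columns by those of $n$-vertex $m$-edge graphs, with $(k,l)$ entry the number of members of $ED_1(G_l)$ isomorphic to $G_k$. $\Delta_1$ is the square matrix indexed by isomorphism classes of $n$-vertex $m$-edge graphs with $(k,l)$ entry the number of members of $MD_1(G_l)$ isomorphic to $G_k$. *)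

(* Defs.v *)
From HB Require Import structures.
From mathcomp Require Import all_boot all_order all_fingroup all_algebra.

Set Implicit Arguments.
Unset Strict Implicit.
Unset Printing Implicit Defensive.

Import GRing.Theory.
Local Open Scope ring_scope.

Definition vpair (n : nat) : Type := {e : {set 'I_n} | #|e| == 2%N}.
HB.instance Definition _ n := SubFinite.on (vpair n).

(* A simple graph on the vertex set 'I_n is its set of edges.  Thus #|G| is   *)
(* its number of edges, G :\ e is G - e, f |: G is G + f and ~: G is the set  *)
(* of its non-edges.                                                          *)
Notation sgraph n := {set vpair n}.

Definition adj n (G : sgraph n) (u v : 'I_n) : bool :=
  [exists e in G, val e == [set u; v]].

Definition iso n (G H : sgraph n) : bool :=
  [exists s : {perm 'I_n}, forall u, forall v, adj G u v == adj H (s u) (s v)].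

Definition iso_classes (n m : nat) : {set {set sgraph n}} :=
  equivalence_partition (@iso n) [set G : sgraph n | #|G| == m].

Notation iso_index n m := 'I_#|iso_classes n m|.

(* A chosen representative of the k-th class; set0 is a dummy value, since    *)
(* the classes are nonempty.                                                  *)
Definition class_graph n m (k : iso_index n m) : sgraph n :=
  odflt set0 [pick G in enum_val k].

(* Finite multisets of graphs are represented by sequences, in which only     *)
(* multiplicities are ever observed.                                          *)
Definition ED1 n (G : sgraph n) : seq (sgraph n) :=
  [seq G :\ e | e <- enum G].

Definition MD1 n (G : sgraph n) : seq (sgraph n) :=
  [seq f |: (G :\ e) | e <- enum G, f <- enum (~: (G :\ e))].

Definition charvec n m (S : seq (sgraph n)) : 'cV[int]_#|iso_classes n m| :=
  \col_(k < #|iso_classes n m|) (count (mem (enum_val k)) S)%:Z.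

(* For m = 0 there are no graphs with m - 1 edges; here m.-1 = 0, so d1 then  *)
(* has one row (that of the edgeless graph), which is zero as ED1 set0 = [::] *)
Definition d1 (n m : nat) :
    'M[int]_(#|iso_classes n m.-1|, #|iso_classes n m|) :=
  \matrix_(k, l) (count (iso (class_graph k)) (ED1 (class_graph l)))%:Z.

Definition Delta1 (n m : nat) : 'M[int]_#|iso_classes n m| :=
  \matrix_(k, l) (count (iso (class_graph k)) (MD1 (class_graph l)))%:Z.

(* Main.v *)
Require Import Defs.
From mathcomp Require Import all_boot all_order all_fingroup all_algebra.

(** Let d be the edge-deletion matrix and u the edge-addition matrix on
isomorphism classes, so that Delta = u d.  Counting the pairs (G, G - e) of
labelled graphs gives |C_k| d_jk = |C_j| u_kj, i.e. u is the adjoint of d for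
the inner products weighted by 1/|C|.  Hence Delta x = 0 implies
0 = <x, u d x> = <d x, d x>, so d x = 0. *)

Set Implicit Arguments.
Unset Strict Implicit.
Unset Printing Implicit Defensive.

Import Order.TTheory GRing.Theory Num.Theory.
Local Open Scope ring_scope.

(** * Linear algebra: the kernel of a product of weighted adjoints *)

Lemma weighted_adjoint_ker p q (A : 'M[int]_(q, p)) (B : 'M[int]_(p, q))
    (a : 'I_p -> nat) (b : 'I_q -> nat) (x : 'cV[int]_p) :
  (forall k, 0 < a k)%N -> (forall j, 0 < b j)%N ->
  (forall k j, (a k)%:Z * A j k = (b j)%:Z * B k j) ->
  B *m A *m x = 0 -> A *m x = 0.
Proof.
move=> a_gt0 b_gt0 AB; rewrite -mulmxA; set y := A *m x => By0.
(* The weights are reciprocals, so the computation moves to the rationals; dividing hypothesis [AB]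
   by [a k * b j] makes it the adjointness relation. *)
pose wa k : rat := (a k)%:R^-1; pose wb j : rat := (b j)%:R^-1.
have adjoint k j : wa k * (B k j)%:~R = wb j * (A j k)%:~R.
  have ak0 : (a k)%:R != 0 :> rat by rewrite pnatr_eq0 -lt0n.
  have bj0 : (b j)%:R != 0 :> rat by rewrite pnatr_eq0 -lt0n.
  apply: (mulfI ak0); apply: (mulfI bj0).
  rewrite mulVKf // mulrCA mulVKf //.
  by rewrite (pmulrn _ (a k)) (pmulrn _ (b j)) -!intrM AB.
have wb_gt0 j : 0 < wb j by rewrite invr_gt0 ltr0n.
have norm0 : \sum_j wb j * (y j 0)%:~R ^+ 2 = 0.
  transitivity (\sum_k wa k * (x k 0)%:~R * ((B *m y) k 0)%:~R); last first.
    by apply: big1 => k _; rewrite By0 mxE mulr0.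
  (* Common expansion of [<y, A x>] and [<x, B y>]: unfold one factor [y] as [A *m x], then swap the
     sums and apply [adjoint]. *)
  transitivity (\sum_j \sum_k wb j * (A j k)%:~R * (x k 0)%:~R * (y j 0)%:~R).
    apply: eq_bigr => j _; rewrite expr2 {1}/y mxE rmorph_sum mulr_suml mulr_sumr.
    by apply: eq_bigr => k _; rewrite /= intrM !mulrA.
  rewrite exchange_big; apply: eq_bigr => k _ /=.
  rewrite [in RHS]mxE rmorph_sum mulr_sumr; apply: eq_bigr => j _ /=.
  by rewrite intrM -adjoint [in RHS]mulrA; congr (_ * _); rewrite mulrAC.
apply/matrixP => j i; rewrite ord1 [RHS]mxE.
have sq_ge0 k : true -> 0 <= wb k * (y k 0)%:~R ^+ 2.
  by rewrite mulr_ge0 ?sqr_ge0 // ltW.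
have /eqP := @psumr_eq0P _ _ predT _ sq_ge0 norm0 j isT.
by rewrite mulf_eq0 (gt_eqF (wb_gt0 _)) sqrf_eq0 intr_eq0 => /eqP.
Qed.

(** * Vertex permutations acting on edges and graphs *)

Section Relabelling.
Variable n : nat.
Implicit Types (s t : {perm 'I_n}) (e : vpair n) (G H J : sgraph n).

Lemma relabel_edge_subproof s e : #|s @: val e| == 2%N.
Proof. by rewrite card_imset ?(valP e) //; apply: perm_inj. Qed.

Definition relabel_edge s e : vpair n := Sub (s @: val e) (relabel_edge_subproof s e).

Lemma val_relabel_edge s e : val (relabel_edge s e) = s @: val e.
Proof. by []. Qed.

Definition relabel s G : sgraph n := relabel_edge s @: G.

Lemma relabel_edge_inj s : injective (relabel_edge s).
Proof.
move=> e f /(congr1 val) /= ef.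
by apply/val_inj/(imset_inj (@perm_inj _ s)).
Qed.

Lemma relabel_edge1 e : relabel_edge 1 e = e.
Proof.
apply/val_inj => /=; rewrite -[RHS]imset_id.
by apply: eq_imset => x; rewrite perm1.
Qed.

Lemma relabel_edgeM s t e : relabel_edge (s * t) e = relabel_edge t (relabel_edge s e).
Proof.
apply/val_inj => /=; rewrite -imset_comp.
by apply: eq_imset => x; rewrite permM.
Qed.

Lemma relabel_edgeKV s : cancel (relabel_edge s^-1) (relabel_edge s).
Proof. by move=> e; rewrite -relabel_edgeM mulVg relabel_edge1. Qed.

Lemma mem_relabel s e G : (relabel_edge s e \in relabel s G) = (e \in G).
Proof. by rewrite mem_imset //; apply: relabel_edge_inj. Qed.

Lemma relabel1 G : relabel 1 G = G.
Proof.
by rewrite /relabel -[RHS]imset_id; apply: eq_imset => x; rewrite relabel_edge1.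
Qed.

Lemma relabelM s t G : relabel (s * t) G = relabel t (relabel s G).
Proof.
by rewrite /relabel -imset_comp; apply: eq_imset => x; rewrite /= relabel_edgeM.
Qed.

Lemma relabelK s : cancel (relabel s) (relabel s^-1).
Proof. by move=> G; rewrite -relabelM mulgV relabel1. Qed.

Lemma card_relabel s G : #|relabel s G| = #|G|.
Proof. by rewrite card_imset //; apply: relabel_edge_inj. Qed.

Lemma relabelD1 s G e : relabel s (G :\ e) = relabel s G :\ relabel_edge s e.
Proof.
apply/setP => f; rewrite -[f](relabel_edgeKV s).
by rewrite !inE !mem_relabel !inE (inj_eq (@relabel_edge_inj s)).
Qed.

Lemma relabelU1 s G e : relabel s (e |: G) = relabel_edge s e |: relabel s G.
Proof. by rewrite /relabel imsetU1. Qed.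

Lemma edgeP e : exists u v, val e = [set u; v].
Proof. by case/cards2P: (valP e) => u [v [_ ->]]; exists u, v. Qed.

Lemma adj_edge G e u v : val e = [set u; v] -> adj G u v = (e \in G).
Proof.
move=> euv; apply/existsP/idP => [[f /andP[fG /eqP fuv]]|eG].
  by rewrite (_ : e = f) //; apply: val_inj; rewrite euv.
by exists e; rewrite eG euv eqxx.
Qed.

Lemma adj_neq G u v : adj G u v -> u != v.
Proof.
case/existsP => e /andP[_ /eqP euv].
by have := valP e; rewrite /= euv cards2; case: (u != v).
Qed.

Lemma adj_relabel s G u v : adj (relabel s G) (s u) (s v) = adj G u v.
Proof.
(* On the diagonal both adjacencies fail, since an edge has two distinct ends; off it, [[set u; v]]
   is a genuine edge. *)
have [<-|uv] := eqVneq u v.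
  by apply/idP/idP => /adj_neq; rewrite eqxx.
have cuv : #|[set u; v]| == 2%N by rewrite cards2 uv.
pose e : vpair n := Sub [set u; v] cuv.
rewrite (@adj_edge G e) // (@adj_edge _ (relabel_edge s e)).
  exact: mem_relabel.
by rewrite /= imsetU1 imset_set1.
Qed.

(** An edge is determined by its two ends, so preserving adjacency of vertices amounts to carrying
    the edge set over. Isomorphism becomes lying in the same orbit, and its equivalence laws follow
    from the group laws. *)
Lemma isoP G H : reflect (exists s, H = relabel s G) (iso G H).
Proof.
apply: (iffP existsP) => [[s /forallP sP]|[s ->]]; exists s; last first.
  by apply/forallP => u; apply/forallP => v; rewrite adj_relabel.
apply/setP => f; rewrite -[f](relabel_edgeKV s).
set e := relabel_edge _ f; have [u [v euv]] := edgeP e.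
have seuv : val (relabel_edge s e) = [set s u; s v].
  by rewrite val_relabel_edge euv imsetU1 imset_set1.
rewrite mem_relabel -(adj_edge H seuv) -(adj_edge G euv).
by have /forallP/(_ v)/eqP := sP u.
Qed.

Lemma iso_refl G : iso G G.
Proof. by apply/isoP; exists 1%g; rewrite relabel1. Qed.

Lemma iso_sym G H : iso G H = iso H G.
Proof.
by apply/isoP/isoP => -[s ->]; exists s^-1%g; rewrite relabelK.
Qed.

Lemma iso_trans G H J : iso G H -> iso H J -> iso G J.
Proof.
by move=> /isoP[s ->] /isoP[t ->]; apply/isoP; exists (s * t)%g; rewrite relabelM.
Qed.

Lemma iso_relabel s G : iso G (relabel s G).
Proof. by apply/isoP; exists s. Qed.

Lemma iso_eqr G H J : iso G H -> iso J G = iso J H.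
Proof.
move=> GH; apply/idP/idP => [JG|JH]; first exact: iso_trans GH.
by apply: (iso_trans JH); rewrite iso_sym.
Qed.

Lemma iso_card G H : iso G H -> #|G| = #|H|.
Proof. by move=> /isoP[s ->]; rewrite card_relabel. Qed.

Lemma iso_equivalence : equivalence_rel (@iso n).
Proof.
move=> G H J; split; first exact: iso_refl.
by move=> GH; rewrite !(iso_sym _ J) (iso_eqr J GH).
Qed.

(** * Counting deletions and additions up to isomorphism *)

Definition deletions J G := #|[set e in G | iso J (G :\ e)]|.

Definition additions J G := #|[set e in ~: G | iso J (e |: G)]|.

Lemma deletions_iso J G H : iso G H -> deletions J G = deletions J H.
Proof.
move=> /isoP[s ->]; rewrite /deletions -(card_imset _ (@relabel_edge_inj s)).
apply: eq_card => f; rewrite -[f](relabel_edgeKV s).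
by rewrite mem_relabel !inE mem_relabel -relabelD1 (iso_eqr J (iso_relabel s _)).
Qed.

Lemma additions_iso J G H : iso G H -> additions J G = additions J H.
Proof.
move=> /isoP[s ->]; rewrite /additions -(card_imset _ (@relabel_edge_inj s)).
apply: eq_card => f; rewrite -[f](relabel_edgeKV s).
by rewrite mem_relabel !inE mem_relabel -relabelU1 (iso_eqr J (iso_relabel s _)).
Qed.

(** For a fixed edge [e], removing [e] is a bijection from the graphs containing [e] to those
    avoiding it, with inverse adding [e]; both sides count the pairs [G], [H = G - e] with [G]
    isomorphic to [K] and [H] to [J]. *)
Lemma sum_deletions (J K : sgraph n) :
  (\sum_(G | iso K G) deletions J G = \sum_(H | iso J H) additions K H)%N.
Proof.
under eq_bigr => G _ do rewrite /deletions -sum1dep_card.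
under [RHS]eq_bigr => H _ do rewrite /additions -sum1dep_card.
rewrite (exchange_big_dep predT) //= [RHS](exchange_big_dep predT) //=.
apply: eq_bigr => e _.
rewrite (reindex_onto (fun H => e |: H) (fun G => G :\ e)) /=; last first.
  by move=> G /and3P[_ eG _]; rewrite setD1K.
apply: eq_bigl => H; rewrite !inE eqxx /=.
(* Reindexing leaves the condition [(e |: H) :\ e == H], which says exactly that [e] is not in
   [H]. *)
have [eH|eH] := boolP (e \in H); last by rewrite setU1K // eqxx andbT andbC.
rewrite andbF; apply/negP => /andP[_ /eqP eq_H].
by move: eH; rewrite -eq_H !inE eqxx.
Qed.

End Relabelling.

(** * Isomorphism classes as matrix indices *)

Section Classes.
Variable n : nat.
Implicit Types G H : sgraph n.

Lemma iso_classes_partition m :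
  partition (iso_classes n m) [set G : sgraph n | #|G| == m].
Proof. by apply: equivalence_partitionP => G H J _ _ _; apply: iso_equivalence. Qed.

Lemma class_graph_mem m (k : iso_index n m) : class_graph k \in enum_val k.
Proof.
rewrite /class_graph; case: pickP => //= k0.
(* The dummy value [set0] would be taken only for an empty class, and a partition has no empty
   block. *)
have /and3P[_ _ /negP[]] := iso_classes_partition m.
rewrite (_ : set0 = enum_val k) ?enum_valP //.
by apply/setP => G; rewrite inE k0.
Qed.

Lemma card_class m (k : iso_index n m) G : G \in enum_val k -> #|G| = m.
Proof.
move=> Gk; have /and3P[/eqP cov _ _] := iso_classes_partition m.
have : G \in cover (iso_classes n m).
  by apply/bigcupP; exists (enum_val k); rewrite ?enum_valP.
by rewrite cov inE => /eqP.
Qed.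

Lemma mem_class m (k : iso_index n m) G :
  (G \in enum_val k) = iso (class_graph k) G.
Proof.
have ck := class_graph_mem k.
have /and3P[_ triv _] := iso_classes_partition m.
have <- : pblock (iso_classes n m) (class_graph k) = enum_val k.
  by apply: def_pblock; rewrite ?enum_valP.
(* The classes partition only the [m]-edge graphs; for any other edge count both sides are false. *)
have [Gm|Gm] := eqVneq #|G| m.
  rewrite pblock_equivalence_partition ?inE ?(card_class ck) ?Gm //.
  by move=> ? ? ? _ _ _; apply: iso_equivalence.
rewrite (def_pblock triv (enum_valP k) ck).
apply/idP/idP => [/card_class/eqP|/iso_card]; first by rewrite (negPf Gm).
by rewrite (card_class ck) => /esym/eqP; rewrite (negPf Gm).
Qed.

Lemma class_exists m G : #|G| = m -> exists k : iso_index n m, iso (class_graph k) G.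
Proof.
move=> Gm; have /and3P[/eqP cov _ _] := iso_classes_partition m.
have : G \in cover (iso_classes n m) by rewrite cov inE Gm.
case/bigcupP => C Cm GC; exists (enum_rank_in Cm C).
by rewrite -mem_class enum_rankK_in.
Qed.

Lemma class_unique m (j k : iso_index n m) G :
  iso (class_graph j) G -> iso (class_graph k) G -> j = k.
Proof.
move=> jG kG; apply: enum_val_inj; apply/setP => H; rewrite !mem_class.
by rewrite ![iso _ H]iso_sym (iso_eqr H jG) (iso_eqr H kG).
Qed.

Definition class_size m (k : iso_index n m) := #|[set G | iso (class_graph k) G]|.

Lemma class_size_gt0 m (k : iso_index n m) : (0 < class_size k)%N.
Proof. by apply/card_gt0P; exists (class_graph k); rewrite inE iso_refl. Qed.

(** Both counts are invariant under isomorphism, so each sum in [sum_deletions] has equal terms and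
    becomes a class size times one entry. This is the adjointness hypothesis, with class sizes as
    weights. *)
Lemma class_size_deletions m p (j : iso_index n m) (k : iso_index n p) :
  (class_size k * deletions (class_graph j) (class_graph k) =
   class_size j * additions (class_graph k) (class_graph j))%N.
Proof.
have := sum_deletions (class_graph j) (class_graph k).
rewrite (eq_bigr (fun=> deletions (class_graph j) (class_graph k))); last first.
  by move=> G kG; rewrite (deletions_iso _ kG).
rewrite [in RHS](eq_bigr (fun=> additions (class_graph k) (class_graph j))).
  by rewrite !sum_nat_cond_const /class_size !cardsE.
by move=> G jG; rewrite (additions_iso _ jG).
Qed.

(** * The matrices and the factorization of [Delta1] *)

Lemma d1E m (j : iso_index n m.-1) (k : iso_index n m) :
  d1 n m j k = (deletions (class_graph j) (class_graph k))%:Z.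
Proof.
rewrite mxE /ED1 count_map /deletions; congr Posz.
by rewrite -sum1dep_card -big_filter_cond -sum1_count.
Qed.

Definition add_matrix m : 'M[int]_(#|iso_classes n m|, #|iso_classes n m.-1|) :=
  \matrix_(k, j) (additions (class_graph k) (class_graph j))%:Z.

(** Forming [G - e + f] is a deletion followed by an addition; grouping the choices of [e] by the
    class of [G - e] gives the matrix product. *)
Lemma Delta1_factor m : Delta1 n m = add_matrix m *m d1 n m.
Proof.
apply/matrixP => k l; rewrite !mxE.
under eq_bigr => j _ do rewrite d1E mxE -PoszM.
rewrite -(big_morph Posz PoszD (erefl 0%:Z)); congr Posz.
rewrite count_flatten -map_comp sumnE big_map big_enum /=.
under [RHS]eq_bigr => j _ do rewrite /deletions -sum1dep_card big_distrr /=.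
rewrite (exchange_big_dep (mem (class_graph l))) /=; last by move=> j e _ /andP[].
apply: eq_bigr => e el; set H := class_graph l :\ e.
(* The edge [e] forces [m] to be positive, so [m.-1] is the true edge count; for [m = 0] there is no
   [e] to sum over. *)
have cH : #|H| = m.-1.
  by rewrite -(card_class (class_graph_mem l)) (cardsD1 e (class_graph l)) el.
have [j jH] := class_exists cH.
(* Exactly one class contains [H], so the sum over classes keeps one term, the number of ways to add
   an edge to [H]. *)
rewrite (big_pred1 j) => [|i]; last first.
  rewrite el /=; apply/idP/eqP => [iH|-> //].
  exact: (@class_unique m.-1 i j H iH jH).
rewrite muln1 (additions_iso _ jH) count_map /additions.
by rewrite -sum1dep_card -big_filter_cond -sum1_count.
Qed.

Lemma Delta1_ker m (x : 'cV[int]_#|iso_classes n m|) :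
  Delta1 n m *m x = 0 -> d1 n m *m x = 0.
Proof.
rewrite Delta1_factor.
apply: (weighted_adjoint_ker (@class_size_gt0 m) (@class_size_gt0 m.-1)) => k j.
by rewrite d1E mxE -!PoszM class_size_deletions.
Qed.

End Classes.

Theorem theorem2p6 (n m : nat) (hn : (1 <= n)%N) (hm : (m <= 'C(n, 2))%N)
    (P Q : seq (sgraph n))
    (hP : forall G : sgraph n, G \in P -> #|G| = m)
    (hQ : forall G : sgraph n, G \in Q -> #|G| = m) :
  Delta1 n m *m charvec m P = Delta1 n m *m charvec m Q ->
  d1 n m *m charvec m P = d1 n m *m charvec m Q.
Proof.
(* By linearity it suffices to treat the difference of the two characteristic vectors, whose entries
   may be negative; the kernel lemma covers every integer vector. *)
move=> DPQ; apply/eqP; rewrite -subr_eq0 -mulmxBr; apply/eqP/Delta1_ker.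
by rewrite mulmxBr DPQ subrr.
Qed.
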